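(* For every constant $L$ there is a polynomial-time algorithm and a function $\varepsilon:\mathbb{N}\to\mathbb{R}_{\ge 0}$ with $\varepsilon(d)\to 0$ as $d\to\infty$ such that, given any finite connected graph $G$ of diameter $d$ together with a tree decomposition of $G$ of length at most $L$, the algorithm outputs a burning schedule that burns all vertices of $G$ within at most $(2+\varepsilon(d))\, bn(G)$ rounds. (That is, the algorithm achieves an approximation factor of $2+o(1)$ for burning graphs of bounded tree-length.)
   Context: Graphs are finite, simple, undirected and unweighted; $d(u,v)$ denotes the shortest-path distance. Burning process: it takes place in synchronous rounds $1,2,\dots$. In each round $i$, every vertex having a neighbour that was burned in an earlier round becomes burned, and additionally one chosen vertex $a_i$ (the activator of round $i$) becomes burned; burned vertices stay burned. A burning schedule $\langle a_1,\dots,a_m\rangle$ burns $G$ in $m$ rounds if all vertices are burned by the end of round $m$, equivalently every vertex $v$ satisfies $d(v,a_i)\le m-i$ for some $i\in\{1,\dots,m\}$. The burning number $bn(G)$ is the minimum $m$ for which a burning schedule burning $G$ in $m$ rounds exists. A tree decomposition of $G$ is a tree whose nodes are finitely many bags, each bag being a subset of the vertices of $G$, such that every edge $\{v,w\}$ of $G$ has both endpoints in some common bag, and for every vertex $v$ of $G$ the bags containing $v$ form a (nonempty) connected subtree. The length of a decomposition is the maximum of $d(x,y)$ (distance in $G$) over all pairs $x,y$ lying in a common bag; the tree-length of $G$ is the minimum length over all its tree decompositions. *)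

(* Defs.v *)
From mathcomp Require Import all_boot.

Set Implicit Arguments.
Unset Strict Implicit.
Unset Printing Implicit Defensive.

Section Graphs.

Variables (V : finType) (e : rel V).

Definition simple_graph : Prop := symmetric e /\ irreflexive e.

Definition connected_graph : Prop :=
  0 < #|V| /\ forall x y : V, connect e x y.

Definition walk (k : nat) (x y : V) : bool :=
  [exists p : k.-tuple V, path e x p && (last x p == y)].

(* A shortest walk has fewer than #|V| edges, so the search range suffices; the
   value is the junk #|V| when y is not reachable from x. *)
Definition gdist (x y : V) : nat := find (fun k => walk k x y) (iota 0 #|V|).

Definition diameter : nat := \max_(x : V) \max_(y : V) gdist x y.

(* cycles of size 2 are the back-and-forth walks along one edge *)
Definition acyclic : Prop := forall c : seq V, ucycle e c -> size c <= 2.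

Definition is_tree : Prop := [/\ simple_graph, connected_graph & acyclic].

Definition burn_round (B : {set V}) (a : V) : {set V} :=
  a |: (B :|: [set v | [exists u in B, e u v]]).

Definition burned (s : seq V) : {set V} := foldl burn_round set0 s.

Definition burns (s : seq V) : bool := burned s == [set: V].

Lemma burns_enum : burns (enum V).
Proof.
have sub : forall (s : seq V) (B : {set V}) (v : V),
    (v \in B) || (v \in s) -> v \in foldl burn_round B s.
  elim=> [|a s IHs] B v /=; first by rewrite orbF.
  rewrite in_cons => h; apply: IHs; rewrite !inE.
  by case/or3P: h => ->; rewrite ?orbT.
by apply/eqP/setP=> v; rewrite inE sub // mem_enum orbT.
Qed.

Lemma burnable : exists m : nat, [exists s : m.-tuple V, burns s].
Proof.
exists (size (enum V)); apply/existsP; exists (in_tuple (enum V)).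
exact: burns_enum.
Qed.

Definition burning_number : nat := ex_minn burnable.

End Graphs.

Section TreeDecompositions.

Variables (V W : finType) (e : rel V) (f : rel W) (bag : W -> {set V}).

Record is_tree_decomposition : Prop := IsTreeDecomposition {
  td_tree : is_tree f;
  td_edge : forall v w : V, e v w -> exists t : W, v \in bag t /\ w \in bag t;
  td_vertex : forall v : V, exists t : W, v \in bag t;
  td_subtree : forall (v : V) (t1 t2 : W), v \in bag t1 -> v \in bag t2 ->
    connect [rel x y | [&& f x y, v \in bag x & v \in bag y]] t1 t2 }.

Definition td_length : nat :=
  \max_(t : W) \max_(x in bag t) \max_(y in bag t) gdist e x y.

End TreeDecompositions.

(* Random access machines with structured control.  The memory consists of
   arrays of natural numbers, indexed by array name and then by address; a
   program mentions finitely many array names, and a scalar variable is an array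
   used at address 0.  As in the standard unit-cost RAM, the arithmetic is
   limited to addition and (truncated) subtraction: without multiplication the
   bit length of the numbers grows by at most one per operation, so that
   polynomial time here is the same as polynomial time on Turing machines
   (Cook and Reckhow, 1973). *)

Definition store : Type := nat -> nat -> nat.

Definition update (s : store) (a i v : nat) : store :=
  fun b j => if (b == a) && (j == i) then v else s b j.

Inductive expr : Type :=
| Const of nat
| Get of nat & expr
| Plus of expr & expr
| Minus of expr & expr.

Fixpoint eval (s : store) (x : expr) : nat :=
  match x with
  | Const n => n
  | Get a y => s a (eval s y)
  | Plus y z => eval s y + eval s z
  | Minus y z => eval s y - eval s z
  end.

Fixpoint expr_cost (x : expr) : nat :=
  match x with
  | Const _ => 1
  | Get _ y => (expr_cost y).+1
  | Plus y z | Minus y z => (expr_cost y + expr_cost z).+1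
  end.

(* [Assign a x y] writes the value of y in array a at address x; a test succeeds
   when its value is nonzero. *)
Inductive program : Type :=
| Skip
| Assign of nat & expr & expr
| Sequence of program & program
| Branch of expr & program & program
| While of expr & program.

(* [exec c s t s']: started in s, c halts in s' after t steps. *)
Inductive exec : program -> store -> nat -> store -> Prop :=
| ExecSkip s : exec Skip s 1 s
| ExecAssign a x y s :
    exec (Assign a x y) s (expr_cost x + expr_cost y).+1
         (update s a (eval s x) (eval s y))
| ExecSequence c1 c2 s1 s2 s3 t1 t2 :
    exec c1 s1 t1 s2 -> exec c2 s2 t2 s3 ->
    exec (Sequence c1 c2) s1 (t1 + t2) s3
| ExecBranch x c1 c2 s s' t :
    exec (if eval s x != 0 then c1 else c2) s t s' ->
    exec (Branch x c1 c2) s (expr_cost x + t).+1 s'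
| ExecWhileStop x c s :
    eval s x = 0 -> exec (While x c) s (expr_cost x).+1 s
| ExecWhileStep x c s1 s2 s3 t1 t2 :
    eval s1 x != 0 -> exec c s1 t1 s2 -> exec (While x c) s2 t2 s3 ->
    exec (While x c) s1 (expr_cost x + t1 + t2).+1 s3.

(* The input word is in array 0, the rest of the memory being 0. *)
Definition input_store (w : seq nat) : store :=
  fun a i => if a == 0 then nth 0 w i else 0.

(* The output is in array 1: its length at address 0, then its entries. *)
Definition output_word (s : store) : seq nat := [seq s 1 i | i <- iota 1 (s 1 0)].

Definition outputs_within (A : program) (w : seq nat) (T : nat) (o : seq nat) :
  Prop := exists t s, [/\ exec A (input_store w) t s, t <= T & output_word s = o].

Definition polynomially_bounded (T : nat -> nat) : Prop :=
  exists a k : nat, forall m : nat, T m <= a * m ^ k + a.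

(* Numbers of vertices and of bags, then the adjacency matrix of the graph, the
   adjacency matrix of the tree, and the bag-vertex incidence matrix, all row by
   row with 0/1 entries; for n > 0 the length of this word is polynomially
   related to its bit length. *)
Definition encode (n N : nat) (e : rel 'I_n) (f : rel 'I_N)
    (bag : 'I_N -> {set 'I_n}) : seq nat :=
  n :: N
    :: [seq nat_of_bool (e x y) | x <- enum 'I_n, y <- enum 'I_n]
    ++ [seq nat_of_bool (f s t) | s <- enum 'I_N, t <- enum 'I_N]
    ++ [seq nat_of_bool (x \in bag t) | t <- enum 'I_N, x <- enum 'I_n].

(* Main.v *)
Require Import Defs.
From mathcomp Require Import all_boot all_order all_algebra.
From mathcomp Require Import all_classical all_reals all_analysis.
From mathcomp Require Import zify lra.

(* The balls of a schedule of length b have radius less than b, so points that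
   are pairwise more than 2b apart lie in distinct balls and number at most b.
   For r = 1, 2, ... the algorithm scans the vertices by decreasing distance from
   a root; an uncovered vertex v gets the centre c that lies r steps from v
   towards the root (or the root itself), which covers the ball of radius r + 2L
   around c.  A bag separating v, x and the root pairwise shows that c covers
   every x with d(v,x) <= 2r that is no farther from the root than v.  Hence the
   vertices v so chosen are pairwise more than 2r apart, and at most r of them
   occur as soon as r reaches bn(G).  Lighting the centres one by one and then
   waiting burns G in 2r + 2L rounds with r <= bn(G); the additive 2L is absorbed
   by eps because packing points on a geodesic gives diam(G) < 3 bn(G)^2.  The
   decomposition serves only in this analysis; the algorithm does not read it. *)

Set Implicit Arguments.
Unset Strict Implicit.
Unset Printing Implicit Defensive.

(** * Distances and burning *)

Section Distance.

Variables (V : finType) (e : rel V).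

Lemma walkP k x y :
  reflect (exists p, [/\ path e x p, last x p = y & size p = k]) (walk e k x y).
Proof.
apply: (iffP existsP) => [[p /andP[ep /eqP <-]] | [p [ep <- <-]]].
  by exists p; rewrite size_tuple.
by exists (in_tuple p); rewrite ep eqxx.
Qed.

Lemma gdist_le_walk k x y : walk e k x y -> gdist e x y <= k.
Proof.
move=> w; rewrite /gdist; case: (ltnP k #|V|) => [k_lt | k_ge].
  rewrite leqNgt; apply/negP => /(before_find 0).
  by rewrite nth_iota // add0n w.
by apply: leq_trans k_ge; rewrite -[leqRHS](size_iota 0) find_size.
Qed.

Lemma gdistxx x : gdist e x x = 0.
Proof. by apply/eqP; rewrite -leqn0 gdist_le_walk //; apply/walkP;
  exists [::]. Qed.

Hypotheses (e_sym : symmetric e) (e_conn : connected_graph e).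

Lemma gdist_ltn x y : gdist e x y < #|V|.
Proof.
rewrite -[ltnRHS](size_iota 0) /gdist -has_find; apply/hasP.
have /connectP[p ep yE] := e_conn.2 x y.
case/shortenP: ep yE => p' ep' up' _ yE.
exists (size p'); last by apply/walkP; exists p'.
by rewrite mem_iota add0n -[_ < _]/(size (x ::
  p') <= _) -(card_uniqP up') max_card.
Qed.

Lemma walk_gdist x y : walk e (gdist e x y) x y.
Proof.
have lt := gdist_ltn x y; have := lt.
rewrite -[ltnRHS](size_iota 0) /gdist -has_find => /(nth_find 0).
by rewrite nth_iota // add0n.
Qed.

Lemma gdist_eq0 x y : gdist e x y = 0 -> x = y.
Proof. by move=> d0; have := walk_gdist x y; rewrite d0 =>
  /walkP[[|? ?] []]. Qed.

Lemma gdist_sym x y : gdist e x y = gdist e y x.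
Proof.
wlog suff: x y / gdist e x y <= gdist e y x.
  by move=> h; apply/eqP; rewrite eqn_leq !h.
apply: gdist_le_walk; have /walkP[p [ep <- <-]] := walk_gdist y x.
apply/walkP; exists (rev (belast y p)); split.
- by rewrite (eq_path (e' := fun z => e^~ z)) ?rev_path.
- by case: p {ep} => //= z p; rewrite rev_cons last_rcons.
- by rewrite size_rev size_belast.
Qed.

Lemma gdist_triangle y x z : gdist e x z <= gdist e x y + gdist e y z.
Proof.
apply: gdist_le_walk.
have /walkP[p [ep lp <-]] := walk_gdist x y.
have /walkP[q [eq lq <-]] := walk_gdist y z.
by apply/walkP; exists (p ++ q); rewrite cat_path last_cat size_cat lp ep eq lq.
Qed.

Lemma gdist_edge y x z : e y z -> gdist e x z <= (gdist e x y).+1.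
Proof.
move=> eyz; rewrite -addn1; apply: leq_trans (gdist_triangle y x z) _.
by rewrite leq_add2l gdist_le_walk //; apply/walkP; exists [:: z];
  rewrite /= eyz.
Qed.

Lemma geodesic_split x y p q :
  path e x (p ++ q) -> last x (p ++ q) = y -> size (p ++ q) = gdist e x y ->
  gdist e x (last x p) = size p /\ gdist e (last x p) y = size q.
Proof.
rewrite cat_path last_cat size_cat => /andP[ep eq] lq sz.
have := gdist_triangle (last x p) x y; rewrite -sz => tri.
have: gdist e x (last x p) <= size p by apply: gdist_le_walk; apply/walkP;
  exists p.
have: gdist e (last x p) y <= size q by apply: gdist_le_walk; apply/walkP;
  exists q.
by lia.
Qed.

Lemma geodesic_mem x y z p :
  path e x p -> last x p = y -> size p = gdist e x y -> z \in x :: p ->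
  gdist e x z + gdist e z y = gdist e x y.
Proof.
move=> + + + zp; case/splitPl: zp => p1 p2 zE ep lp sp.
have [d1 d2] := geodesic_split ep lp sp.
by rewrite -sp size_cat -zE d1 d2.
Qed.

Lemma geodesic_point x y k : k <= gdist e x y ->
  exists2 z, gdist e x z = k & gdist e z y = gdist e x y - k.
Proof.
have /walkP[p [ep lp sp]] := walk_gdist x y => kle.
move: ep lp sp; rewrite -{1 2 3}(cat_take_drop k p) => ep lp sp.
have [] := geodesic_split ep lp sp.
rewrite size_drop size_take_min => d1 d2.
exists (last x (take k p)); rewrite ?d1 ?d2; move: sp;
  rewrite size_cat size_drop size_take_min; lia.
Qed.

Lemma gdist_pred x z k : gdist e x z = k.+1 ->
  exists2 y, gdist e x y = k & e y z.
Proof.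
move=> dk; have /walkP[p [ep lp sp]] := walk_gdist x z.
case/lastP: p ep lp sp => [|p z'] ep lp sp; first by rewrite -sp in dk.
move: ep lp sp; rewrite -cats1 => ep lp sp; have [d1 _] :=
  geodesic_split ep lp sp.
exists (last x p); first by move: sp; rewrite size_cat dk d1 addn1 => -[].
by move: ep lp; rewrite cat_path last_cat /= andbT => /andP[_ +] <-.
Qed.

(** Positions count from 0, so the activator at position [i] has [size s - i - 1] rounds left in
    which to spread; hence the strict inequality. *)
Lemma burnedP s v :
  v \in burned e s <->
  exists2 i, i < size s & gdist e (nth v s i) v < size s - i.
Proof.
split=> [|[i]].
  elim/last_ind: s v => [|s a IHs] v; first by rewrite inE.
  rewrite /burned foldl_rcons -/(burned e s) size_rcons !inE.
  case/or3P => [/eqP->|/IHs[i lti di]|].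
  - by exists (size s); rewrite // nth_rcons ltnn eqxx gdistxx subSnn.
  - by exists i; rewrite ?nth_rcons ?lti; lia.
  - case/exists_inP=> u /IHs[i lti di] euv; exists i; first lia.
    rewrite nth_rcons lti (set_nth_default u) //.
    by have := gdist_edge (nth u s i) euv; lia.
elim/last_ind: s v i => [|s a IHs] v i //.
rewrite /burned foldl_rcons -/(burned e s) size_rcons !inE nth_rcons.
case: (ltngtP i (size s)) => //= [lti _ dlt|lti|-> _]; last 2 first.
- by rewrite ltnS leqNgt lti.
- by rewrite subSnn ltnS leqn0 => /eqP/gdist_eq0->; rewrite eqxx.
(* Either the ball reached [v] a round earlier, or [v] is at distance exactly [size s - i] and its
   predecessor on a shortest walk was burned by then. *)
have [/(IHs _ _ lti)->|dge] := ltnP (gdist e (nth v s i) v) (size s - i).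
  by rewrite orbT.
apply/orP; right; apply/orP; right; apply/exists_inP.
have /gdist_pred[u du euv] : gdist e (nth v s i) v = (size s - i).-1.+1 by lia.
by exists u => //; apply: (IHs _ i); rewrite // (set_nth_default v) // du; lia.
Qed.

Lemma burnsP s :
  burns e s <->
  forall v, exists2 i, i < size s & gdist e (nth v s i) v < size s - i.
Proof.
split=> [/eqP bs v|bs]; first by apply/burnedP; rewrite bs inE.
by apply/eqP/setP => v; rewrite inE; apply/burnedP.
Qed.

(** Two points in one ball of radius below [r] are less than [2r] apart, so sending a point to the
    first activator at distance below [r] is injective on [ps]. *)
Lemma burns_packing s r ps : burns e s -> size s <= r ->
  pairwise (fun p q => r.*2 < gdist e p q) ps -> size ps <= size s.
Proof.
move=> /burnsP bs sr pw.
pose h p := find (fun a => gdist e a p < r) s.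
have hP p : h p < size s /\ gdist e (nth p s (h p)) p < r.
  have /[dup] : has (fun a => gdist e a p < r) s.
    have [i lti di] := bs p; apply/(has_nthP p); exists i => //; lia.
  by rewrite {1}has_find => ? /(nth_find p).
rewrite -(size_map h) -(size_iota 0 (size s)); apply: uniq_leq_size.
  rewrite uniq_pairwise pairwise_map; apply: sub_pairwise pw => p q far.
  apply/eqP => /= hpq; have [lt_p dp] := hP p; have [_ dq] := hP q.
  rewrite -hpq (set_nth_default p) // in dq.
  have := gdist_triangle (nth p s (h p)) p q; rewrite (gdist_sym p (nth _ _ _)).
  by move: dp dq far; rewrite -addnn; lia.
by move=> _ /mapP[p _ ->]; rewrite mem_iota /= add0n; case: (hP p).
Qed.

Lemma burning_numberP :
  exists2 s, burns e s & size s = burning_number e.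
Proof.
rewrite /burning_number; case: ex_minnP => m /existsP[s bs] _.
by exists s; rewrite ?size_tuple.
Qed.

Lemma burning_number_gt0 : 0 < burning_number e.
Proof.
have [s /burnsP bs <-] := burning_numberP.
by have /card_gt0P[v _] := e_conn.1; have [i] := bs v; lia.
Qed.

Lemma burning_number_le_card : burning_number e <= #|V|.
Proof.
rewrite /burning_number; case: ex_minnP => m _; apply.
rewrite cardE; apply/existsP; exists (in_tuple (enum V)); exact: burns_enum.
Qed.

Lemma burning_number_packing r ps : burning_number e <= r ->
  pairwise (fun p q => r.*2 < gdist e p q) ps -> size ps <= burning_number e.
Proof. have [s bs <-] := burning_numberP; exact: burns_packing bs. Qed.

(** With [w = 2m + 1], points at distances 0, [w], [2w], ... from [x] are pairwise more than [2m]
    apart by the triangle inequality alone. Packing gives [d %/ w < m], so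
    [d < m * w <= 3 * m ^ 2]. *)
Lemma diameter_lt_burning_number :
  diameter e < 3 * burning_number e ^ 2.
Proof.
set m := burning_number e; have m_gt0 : 0 < m := burning_number_gt0.
suff bd x y : gdist e x y < 3 * m ^ 2.
  have pos : 0 < 3 * m ^ 2 by rewrite muln_gt0 expn_gt0 m_gt0.
  rewrite /diameter -(prednK pos) ltnS; apply/bigmax_leqP => x _.
  by apply/bigmax_leqP => y _; rewrite -ltnS prednK.
set d := gdist e x y; set w := m.*2.+1.
have pt j : j <= d %/ w -> exists z, gdist e x z == j * w.
  rewrite leq_divRL // => /geodesic_point[z dz _].
  by exists z; rewrite dz.
pose g j := odflt x [pick z | gdist e x z == j * w].
have gP j : j <= d %/ w -> gdist e x (g j) = j * w.
  move/pt => [z dz]; rewrite /g; case: pickP => [z' /eqP //|/(_ z)].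
  by rewrite dz.
have := @burning_number_packing m [seq g j | j <- iota 0 (d %/ w).+1] (leqnn _).
rewrite size_map size_iota pairwise_map -/m => packed.
have {packed} : d %/ w < m.
  apply: packed; apply: (@sub_in_pairwise _ (mem (iota 0 (d %/ w).+1)) ltn).
  - move=> i j; rewrite !mem_iota !add0n !ltnS => /= iw jw ij.
    have := gdist_triangle (g i) x (g j); rewrite !gP // => tri.
    have : i.+1 * w <= j * w by rewrite leq_mul2r ij orbT.
    by rewrite mulSn {1}/w; lia.
  - exact/allP.
  - by rewrite -sorted_pairwise ?iota_ltn_sorted //; exact: ltn_trans.
by rewrite ltn_divLR // /w; nia.
Qed.

End Distance.

(** * Bags as separators *)

Section Tree.

Variables (W : finType) (f : rel W).
Hypothesis f_tree : is_tree f.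

Definition avoid (t : W) : rel W := [rel x y | [&& f x y, x != t & y != t]].

(** In a tree: [t] lies on the path from [a] to [b], ends included. *)
Definition cuts (t a b : W) : bool :=
  [|| t == a, t == b | ~~ connect (avoid t) a b].

Let f_sym : symmetric f. Proof. by case: f_tree => -[]. Qed.
Let f_conn : connected_graph f. Proof. by case: f_tree. Qed.

Lemma avoid_sym t : connect_sym (avoid t).
Proof.
by apply: sym_connect_sym => x y; rewrite /avoid /= f_sym; case:
  (x != t) (y != t) => [] [].
Qed.

Lemma path_avoid t x p : path f x p -> t \notin x :: p -> path (avoid t) x p.
Proof.
elim: p x => //= y p IHp x /andP[fxy fp]; rewrite !inE !negb_or =>
  /and3P[tx ty tp].
by rewrite {1}/avoid /= fxy eq_sym tx eq_sym ty /= IHp // inE negb_or ty.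
Qed.

Lemma avoid_path t x p : x != t -> path (avoid t) x p ->
  path f x p /\ t \notin x :: p.
Proof.
move=> xt; elim: p x xt =>
  [x xt _|y p IHp x xt /= /andP[/and3P[fxy _ yt] /IHp]].
  by rewrite mem_seq1 eq_sym.
by case=> // -> tp; rewrite fxy inE negb_or eq_sym xt.
Qed.

(** A simple path from [u] to [w] off [t] closes up with [t] into a cycle; acyclicity bounds its
    size by 2, so the path is trivial. *)
Lemma neighbours_separated t u w : f u t -> f t w ->
  connect (avoid t) u w -> u = w.
Proof.
move=> fut ftw; have ut : u != t.
  by apply: contraTneq fut => ->; case: f_tree => -[_ ->].
case/connectP=> p ap wE; move: ftw; rewrite {w}wE.
case/shortenP: ap => p' ap' up' _ ftw; have [fp tp] := avoid_path ut ap'.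
have [_ _ /(_ (t :: u :: p'))] := f_tree; rewrite /ucycle /= rcons_path fp.
move: tp up'; rewrite f_sym in fut; rewrite fut f_sym ftw /= => -> -> /(_ isT).
by case: (p').
Qed.

(** Were [a] and [c] connected off [t], the node before [t] on the path and the node before [t] on a
    geodesic from [c] would be neighbours of [t] connected off [t], hence equal: a node of the path
    closer to [c] than [t]. *)
Lemma closest_on_path_cuts a p c t : path f a p -> uniq (a :: p) ->
  t \in a :: p ->
  (forall t', t' \in a :: p -> gdist f c t <= gdist f c t') -> cuts t a c.
Proof.
move=> fp up; rewrite inE /cuts => /predU1P[->|tp closest];
  first by rewrite eqxx.
apply/orP; right; have [//|tc /=] := eqVneq t c; apply/negP => ac.
case/splitPr: tp fp up closest => p1 p2.
rewrite cat_path -cat_cons cat_uniq => /andP[fp1 /andP[fut _]] /and3P[_ + _] /=.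
rewrite negb_or => /andP[tp1 _] closest.
have au : connect (avoid t) a (last a p1).
  by apply/connectP; exists p1; rewrite ?path_avoid.
have: gdist f c t != 0.
  by apply: contraNneq tc => /(gdist_eq0 f_conn) ->.
case dt: (gdist f c t) => [//|k] _.
have [y dy fyt] := gdist_pred f_conn dt.
have cy : connect (avoid t) c y.
  have /walkP[q [fq lq sq]] := walk_gdist f_conn c y.
  apply/connectP; exists q; rewrite ?lq ?path_avoid //; apply/negP => tq.
  by have := geodesic_mem f_conn fq lq sq tq; lia.
have : last a p1 = y; last move=> uy.
  apply: (neighbours_separated fut); first by rewrite f_sym.
  by rewrite avoid_sym in au; apply: connect_trans au (connect_trans ac cy).
have := closest (last a p1); rewrite -cat_cons mem_cat mem_last uy dt dy ltnn.
by move=> /(_ isT).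
Qed.

(** The witness is the node closest to [c] on a simple path from [a] to [b]. *)
Lemma median a b c : exists t, [/\ cuts t a b, cuts t a c & cuts t b c].
Proof.
have /connectP[p0 fp0 bE] := f_conn.2 a b.
case/shortenP: fp0 bE => p fp up _ bE {p0}.
case: (arg_minnP (gdist f c) (mem_head a p)) => t tp closest.
exists t; split; last 1 first.
- apply: (@closest_on_path_cuts _ (rev (belast a p))).
  + by rewrite bE (eq_path (e' := fun z => f^~ z)) ?rev_path.
  + by rewrite bE -rev_rcons -lastI rev_uniq.
  + by rewrite bE -rev_rcons -lastI mem_rev.
  + by move=> t'; rewrite bE -rev_rcons -lastI mem_rev; apply: closest.
(* If removing [t] left [a] and [b] connected, the two neighbours of [t] on the path would coincide,
   although the path is simple. *)
- rewrite /cuts; have [//|ta /=] := eqVneq t a; have [//|tb /=] := eqVneq t b.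
  have /predU1P[/eqP|{}tp] : t \in a :: p by []; first by rewrite (negPf ta).
  case/splitPr: tp fp up bE {closest}.
  move=> p1 [|w p2]; first by rewrite last_cat /= => _ _ tb';
    rewrite tb' eqxx in tb.
  rewrite cat_path last_cat -cat_cons cat_uniq.
  move=> /andP[fp1 /and3P[fut ftw fp2]] /and3P[_ /hasPn out /andP[tp2 _]] /= bE.
  have tp1 : t \notin a :: p1 by apply: out; rewrite mem_head.
  have wp1 : w \notin a :: p1 by apply: out; rewrite !inE eqxx orbT.
  have au : connect (avoid t) a (last a p1).
    by apply/connectP; exists p1; rewrite ?path_avoid.
  have wb : connect (avoid t) w b.
    by apply/connectP; exists p2; rewrite ?path_avoid.
  apply/negP => ab; rewrite avoid_sym in au; rewrite avoid_sym in wb.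
  have uw := neighbours_separated fut ftw
    (connect_trans au (connect_trans ab wb)).
  by rewrite -uw mem_last in wp1.
- exact: closest_on_path_cuts tp closest.
Qed.

End Tree.

(** * Covering by a centre, in graphs of bounded tree-length *)

Section TreeLength.

Variables (V W : finType) (e : rel V) (f : rel W) (bag : W -> {set V}) (L :
  nat).
Hypotheses (e_simple : simple_graph e) (e_conn : connected_graph e).
Hypotheses (decomp : is_tree_decomposition e f bag) (len :
  td_length e bag <= L).

Let e_sym : symmetric e. Proof. by case: e_simple. Qed.

Lemma gdist_bag t x y : x \in bag t -> y \in bag t -> gdist e x y <= L.
Proof.
move=> xt yt; apply: leq_trans len; rewrite /td_length.
rewrite (bigD1 t) //= (bigD1 x) //= (bigD1 y) //=.
by rewrite -!maxnA leq_maxl.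
Qed.

(** If the walk missed bag [t], the subtrees of its vertices would avoid [t]; consecutive ones share
    a node by the edge condition, so together they would connect [a] to [b] off [t]. *)
Lemma bag_meets_path t a b x y p : cuts f t a b -> x \in bag a -> y \in bag b ->
  path e x p -> last x p = y -> exists2 z, z \in x :: p & z \in bag t.
Proof.
move=> cut xa yb ep lp.
have [/hasP[z zp zt]|/hasPn none] := boolP (has (mem (bag t)) (x :: p)).
  by exists z.
suff ab : connect (avoid f t) a b.
  case/or3P: cut => [/eqP ta|/eqP tb|]; last by rewrite ab.
    by have := none x (mem_head _ _); rewrite /= ta xa.
  by have := none y; rewrite -lp mem_last lp /= tb yb => /(_ isT).
have within z s1 s2 : z \notin bag t -> z \in bag s1 -> z \in bag s2 ->
    connect (avoid f t) s1 s2.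
  move=> zt z1 z2; have := td_subtree decomp z1 z2; apply: connect_sub =>
    u w /=.
  case/and3P=> fuw zu zw; apply: connect1; rewrite /avoid /= fuw /=.
  by apply/andP; split; apply: contraNneq zt => <-.
elim: p x a {cut} xa ep lp none => [x a xa _ /= xy none|z p IHp x a xa].
  by apply: (within x); [apply: none; rewrite mem_head | | rewrite xy].
move=> /= /andP[exz ep] lp none.
have [s [xs zs]] := td_edge decomp exz.
apply: (@connect_trans _ _ s).
  by apply: (within x) => //; apply: none; rewrite mem_head.
by apply: (IHp z) => // u up; apply: none; rewrite inE up orbT.
Qed.

Lemma bag_meets_geodesic t a b x y : cuts f t a b -> x \in bag a ->
  y \in bag b ->
  exists2 z, z \in bag t & gdist e x z + gdist e z y = gdist e x y.
Proof.
move=> cut xa yb; have /walkP[p [ep lp sp]] := walk_gdist e_conn x y.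
have [z zp zt] := bag_meets_path cut xa yb ep lp.
by exists z => //; apply: (geodesic_mem e_conn ep lp sp).
Qed.

Lemma retreat_covers root v x c r :
  gdist e root x <= gdist e root v -> gdist e v x <= r.*2 ->
  gdist e v c <= r -> gdist e root c <= gdist e root v - r ->
  gdist e c x <= r + L.*2.
Proof.
move=> d_x vx vc root_c.
have dsym := gdist_sym e_sym e_conn; have tri := gdist_triangle e_conn.
(* Here the truncated subtraction forces [c] to be [root], and [x] is no farther from [root] than
   [v]. *)
have [near|far] := leqP (gdist e root v) r.
  have -> : c = root by apply/esym/(gdist_eq0 e_conn); lia.
  by lia.
have tri1 := tri c root v; rewrite (dsym c v) in tri1.
have [a xa] := td_vertex decomp x; have [b vb] := td_vertex decomp v.
have [w rw] := td_vertex decomp root.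
have [t [tab taw tbw]] := median (td_tree decomp) a b w.
have [y1 y1t y1E] := bag_meets_geodesic tab xa vb.
have [y2 y2t y2E] := bag_meets_geodesic taw xa rw.
have /walkP[q1 [eq1 lq1 sq1]] := walk_gdist e_conn v c.
have /walkP[q2 [eq2 lq2 sq2]] := walk_gdist e_conn c root.
have [z] : exists2 z, z \in v :: (q1 ++ q2) & z \in bag t.
  by apply: (bag_meets_path tbw vb rw); rewrite ?cat_path ?last_cat ?eq1 lq1.
rewrite -cat_cons mem_cat => zq zt.
(* If [z] precedes [c], the geodesic from [x] to [root] through [y2] gives d(z,x) <= d(v,z) + 2L, as
   [x] is no farther from [root] than [v]. If [z] follows [c], the geodesic from [x] to [v] through
   [y1] gives d(z,x) <= 2r - d(v,z) + 2L, where d(v,z) >= r + d(c,z). Either way d(c,x) <= r +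
   2L. *)
have zc : gdist e v z + gdist e z c = gdist e v c \/
          gdist e c z + gdist e z root = gdist e c root.
  case/orP: zq => [zq1|zq2]; [left | right].
    exact: (geodesic_mem e_conn eq1 lq1 sq1).
  by apply: (geodesic_mem e_conn eq2 lq2 sq2); rewrite inE zq2 orbT.
have := gdist_bag y1t zt; have := gdist_bag y2t zt.
have := tri z c x; have := tri y1 z x; have := tri y2 z x.
have := tri y1 v z; have := tri y2 root z; have := tri z root v.
rewrite -addnn in vx *.
move: (dsym y1 x) (dsym y2 x) (dsym y1 v) (dsym y2 root).
move: (dsym y1 z) (dsym y2 z).
move: (dsym z c) (dsym z v) (dsym z root) (dsym c root).
move: (dsym x v) (dsym x root).
lia.
Qed.

End TreeLength.

(** * Running time and program rules *)

Section PolynomialBounds.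

(** With the positive base [m.+1] the additive constant is absorbed and a larger exponent never
    lowers the bound, so sums and products need only add exponents. *)
Lemma polynomially_boundedP (T : nat -> nat) :
  polynomially_bounded T <-> exists a k, forall m, T m <= a * m.+1 ^ k.
Proof.
split=> -[a [k bd]].
  exists a.*2, k => m; apply: leq_trans (bd m) _.
  have : m ^ k <= m.+1 ^ k by case: k {bd} => // k; rewrite leq_exp2r.
  have : 0 < m.+1 ^ k by rewrite expn_gt0.
  by rewrite -addnn mulnDl; nia.
exists (a * 2 ^ k), k => m; apply: leq_trans (bd m) _.
case: m => [|m].
  rewrite exp1n muln1 -[leqLHS]muln1; apply: leq_trans (leq_addl _ _).
  by rewrite leq_mul2l expn_gt0 orbT.
apply: leq_trans (leq_addr _ _); rewrite -mulnA -expnMn leq_mul2l.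
by apply/orP; right; case: k {bd} => // k; rewrite leq_exp2r //; lia.
Qed.

Lemma polynomially_bounded_const c : polynomially_bounded (fun=> c).
Proof. by exists c, 0 => m; rewrite leq_addl. Qed.

Lemma polynomially_bounded_id : polynomially_bounded id.
Proof. by exists 1, 1 => m; rewrite mul1n leq_addr. Qed.

Lemma polynomially_bounded_add S T : polynomially_bounded S ->
  polynomially_bounded T -> polynomially_bounded (fun m => S m + T m).
Proof.
move=> /polynomially_boundedP[a [k bS]] /polynomially_boundedP[b [l bT]].
apply/polynomially_boundedP; exists (a + b), (k + l) => m.
rewrite mulnDl leq_add // ?(leq_trans (bS m)) ?(leq_trans (bT m)) //;
  by rewrite leq_mul2l leq_pexp2l ?orbT // ?leq_addr ?leq_addl.
Qed.

Lemma polynomially_bounded_mul S T : polynomially_bounded S ->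
  polynomially_bounded T -> polynomially_bounded (fun m => S m * T m).
Proof.
move=> /polynomially_boundedP[a [k bS]] /polynomially_boundedP[b [l bT]].
apply/polynomially_boundedP; exists (a * b), (k + l) => m.
by rewrite expnD mulnACA leq_mul.
Qed.

End PolynomialBounds.

Fixpoint writes (c : program) : seq nat :=
  match c with
  | Skip => [::]
  | Assign a _ _ => [:: a]
  | Sequence c1 c2 | Branch _ c1 c2 => writes c1 ++ writes c2
  | While _ c => writes c
  end.

Lemma exec_frame c s t s' a : exec c s t s' -> a \notin writes c -> s' a =1 s a.
Proof.
move=> ex; elim: {c s t s'} ex => //=.
- by move=> b x y s; rewrite mem_seq1 /update => /negPf->.
- move=> c1 c2 s1 s2 s3 _ _ _ IH1 _ IH2; rewrite mem_cat negb_or.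
  by case/andP=> /IH1 s12 /IH2 s23 i; rewrite s23.
- move=> x c1 c2 s s' _ _; case: ifP => _ IH; rewrite mem_cat negb_or.
    by case/andP=> /IH.
  by case/andP=> _ /IH.
- by move=> x c s1 s2 s3 _ _ _ _ IH1 _ IH2 ac i; rewrite IH2 ?IH1.
Qed.

(* Bounds the running time of c in every run in which each loop of c makes at
   most m iterations whenever it is entered. *)
Fixpoint time_bound (m : nat) (c : program) : nat :=
  match c with
  | Skip => 1
  | Assign _ x y => (expr_cost x + expr_cost y).+1
  | Sequence c1 c2 => time_bound m c1 + time_bound m c2
  | Branch x c1 c2 => (expr_cost x + (time_bound m c1 + time_bound m c2)).+1
  | While x c => m * (expr_cost x + time_bound m c).+1 + (expr_cost x).+1
  end.

Lemma time_bound_polynomial c : polynomially_bounded (time_bound^~ c).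
Proof.
have const := polynomially_bounded_const.
have add := polynomially_bounded_add.
elim: c => [|a x y|c1 IH1 c2 IH2|x c1 IH1 c2 IH2|x c IHc].
- exact: const.
- exact: const.
- exact: add.
- exact: (add (fun=> (expr_cost x).+1) _ (const _) (add _ _ IH1 IH2)).
- apply: (add (fun m => m * _) (fun=> _) _ (const _)).
  apply: (polynomially_bounded_mul polynomially_bounded_id).
  exact: (add (fun=> (expr_cost x).+1) _ (const _) IHc).
Qed.

(** Total correctness in weakest-precondition style, carrying the time bound so that output and
    running time are verified together. *)
Definition runs (m : nat) (c : program) (s : store) (Q : store -> Prop) :
  Prop :=
  exists t s', [/\ exec c s t s', t <= time_bound m c & Q s'].

Section Rules.

Variable m : nat.
Implicit Types (c : program) (s : store) (Q : store -> Prop).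

Lemma runs_frame c s Q :
  runs m c s (fun s' => (forall a, a \notin writes c -> s' a =1 s a) -> Q s') ->
  runs m c s Q.
Proof.
case=> t [s' [ex tm Qs']]; exists t, s'; split=> //; apply: Qs' => a.
exact: exec_frame ex.
Qed.

Lemma runs_skip s Q : Q s -> runs m Skip s Q.
Proof. by exists 1, s; split=> //; apply: ExecSkip. Qed.

Lemma runs_assign a x y s Q :
  Q (update s a (Defs.eval s x) (Defs.eval s y)) -> runs m (Assign a x y) s Q.
Proof. by move=> Qs; do 2![eexists]; split; [exact: ExecAssign | | ]. Qed.

Lemma runs_sequence c1 c2 s Q :
  runs m c1 s (fun s' => runs m c2 s' Q) -> runs m (Sequence c1 c2) s Q.
Proof.
case=> t1 [s1 [ex1 tm1 [t2 [s2 [ex2 tm2 Qs2]]]]].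
by exists (t1 + t2), s2; split; [apply: ExecSequence ex1 ex2 | apply:
  leq_add | ].
Qed.

Lemma runs_branch x c1 c2 s Q :
  (Defs.eval s x != 0 -> runs m c1 s Q) -> (Defs.eval s x = 0 ->
    runs m c2 s Q) ->
  runs m (Branch x c1 c2) s Q.
Proof.
move=> run1 run2.
have [t [s' [ex tm Qs']]] : runs m (if Defs.eval s x != 0 then c1 else c2) s Q.
  by case: ifPn => [/run1 // | /negPn/eqP/run2].
exists (expr_cost x + t).+1, s'; split=> //; first exact: ExecBranch.
by rewrite ltnS leq_add2l (leq_trans tm) //=; case: ifP => _;
  rewrite ?leq_addr ?leq_addl.
Qed.

End Rules.

Definition var (a : nat) : expr := Get a (Const 0).

Definition incr (x : expr) : expr := Plus x (Const 1).

(* All loops run over the vertices, whose number is the first input entry. *)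
Definition for_vertices (i : nat) (c : program) : program :=
  Sequence (Assign i (Const 0) (Const 0))
    (While (Minus (var 0) (var i))
       (Sequence c (Assign i (Const 0) (incr (var i))))).

(** The increment closes each iteration, so the body must establish the invariant for the store with
    the counter already advanced. Array 0 is never written, so [s 0 0] remains the bound. *)
Lemma runs_for m i c s (I : nat -> store -> Prop) (Q : store -> Prop) :
  s 0 0 <= m -> 0 \notin writes (for_vertices i c) -> i \notin writes c ->
  I 0 (update s i 0 0) ->
  (forall k s1, k < s 0 0 -> s1 i 0 = k ->
     (forall a, a \notin writes (for_vertices i c) -> s1 a =1 s a) -> I k s1 ->
     runs m c s1 (fun s2 => I k.+1 (update s2 i 0 k.+1))) ->
  (forall s1, (forall a, a \notin writes (for_vertices i c) -> s1 a =1 s a) ->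
     I (s 0 0) s1 -> Q s1) ->
  runs m (for_vertices i c) s Q.
Proof.
have writesE a : a \notin writes (for_vertices i c) = (a \notin i :: writes c).
  by rewrite /= inE mem_cat mem_seq1 orbCA orbb orbC.
set n := s 0 0 => nm n_kept i_kept I0 body done.
apply/runs_sequence/runs_assign.
set x := Minus _ _; set c' := Sequence c _.
(* Induction on the number [j] of iterations still to come. *)
suff: forall j k s1, j + k = n -> s1 i 0 = k ->
    (forall a, a \notin writes (for_vertices i c) -> s1 a =1 s a) -> I k s1 ->
    exists t s2, [/\ exec (While x c') s1 t s2,
      t <= j * (expr_cost x + time_bound m c').+1 + (expr_cost x).+1 & Q s2].
  move=> /(_ n 0 (update s i 0 0)) [].
  - by rewrite addn0.
  - by rewrite /update !eqxx.
  - move=> a; rewrite writesE inE negb_or => /andP[/negPf ai _] j.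
    by rewrite /update ai.
  - exact: I0.
  - move=> t [s2 [ex tm Qs2]]; exists t, s2; split=> //.
    by rewrite (leq_trans tm) //= leq_add2r leq_mul2r nm orbT.
elim=> [|j IHj] k s1 jk s1k fr Ik.
  have s1n : Defs.eval s1 x = 0 by rewrite /= fr // s1k -/n -jk subnn.
  exists (expr_cost x).+1, s1; split=> //; first exact: ExecWhileStop.
  by apply: done; rewrite // -/n -jk.
have kn : k < n by rewrite -jk addSn ltnS leq_addl.
have [t1 [s2 [ex1 tm1 Ik1]]] := body k s1 kn s1k fr Ik.
have fr2 a : a \notin writes c -> s2 a =1 s1 a by apply: exec_frame ex1.
have s2k : s2 i 0 = k by rewrite fr2.
have ex2 := ExecAssign i (Const 0) (incr (var i)) s2.
have [|||t3 [s3 [ex3 tm3 Qs3]]] :=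
    IHj k.+1 (update s2 i 0 k.+1) _ _ _ Ik1.
- by rewrite addnS.
- by rewrite /update !eqxx.
- move=> a; rewrite writesE inE negb_or => /andP[ai ac] l.
  by rewrite /update (negPf ai) fr2 // fr // writesE inE negb_or ai.
rewrite /= s2k (addn1 k) in ex2.
do 2![eexists]; split; last exact: Qs3.
  apply: ExecWhileStep ex3; last exact: ExecSequence ex1 ex2.
  by rewrite /= fr // s1k subn_eq0 -ltnNge.
rewrite /= in tm3 *; rewrite mulSn; lia.
Qed.

(** * The algorithm *)

(* The machine cannot multiply, so ROW x holds x * n.  Memory is 0 at the start;
   NEAR[x,z] therefore holds n - d(x,z), for which 0 says that no walk has been
   found.  STAMP x is the last radius for which x was covered, which saves
   clearing it between radii.  Arrays 7 to 14 are used at address 0 only, as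
   loop variables: 11 is the radius minus 1, 12 the level of the scan, 13 the
   vertex being scanned. *)
Notation IN := 0 (only parsing).
Notation OUT := 1 (only parsing).
Notation ROW := 2 (only parsing).
Notation NEAR := 3 (only parsing).
Notation STAMP := 4 (only parsing).
Notation CENTRE := 5 (only parsing).
Notation COUNT := 6 (only parsing).

Definition vertex_count : expr := var IN.
Definition entry_expr (a : nat) (x y : expr) : expr :=
  Get a (Plus (Get ROW x) y).
Definition edge_expr (x y : expr) : expr :=
  Get IN (Plus (Const 2) (Plus (Get ROW x) y)).
Definition dist_expr (x y : expr) : expr :=
  Minus vertex_count (entry_expr NEAR x y).

Definition tables : program :=
  for_vertices 7 (Sequence
    (Assign NEAR (Plus (Get ROW (var 7)) (var 7)) vertex_count)
    (Assign ROW (incr (var 7)) (Plus (Get ROW (var 7)) vertex_count))).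

(* NEAR[x,z] becomes the maximum of itself and NEAR[x,y] - 1. *)
Definition relax : program :=
  for_vertices 7 (for_vertices 8 (for_vertices 9 (for_vertices 10
    (Branch (edge_expr (var 9) (var 10))
       (Assign NEAR (Plus (Get ROW (var 8)) (var 10))
          (Plus (entry_expr NEAR (var 8) (var 10))
             (Minus (Minus (entry_expr NEAR (var 8) (var 9)) (Const 1))
                (entry_expr NEAR (var 8) (var 10)))))
       Skip)))).

Definition radius : expr := incr (var 11).

(** A sum of truncated differences is 0 exactly when every inequality holds, so failing candidates
    take the [Skip] branch. The last suitable vertex stays in [CENTRE]. *)
Definition search : program :=
  for_vertices 14 (Branch
    (Plus (Minus (dist_expr (var 13) (var 14)) radius)
       (Minus (dist_expr (Const 0) (var 14))
          (Minus (dist_expr (Const 0) (var 13)) radius)))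
    Skip
    (Assign CENTRE (Const 0) (var 14))).

Definition mark (slack : nat) : program :=
  for_vertices 14 (Branch
    (Minus (dist_expr (var CENTRE) (var 14)) (Plus radius (Const slack)))
    Skip
    (Assign STAMP (var 14) radius)).

Definition pick (slack : nat) : program :=
  Sequence search (Sequence (mark slack)
    (Sequence (Assign COUNT (Const 0) (incr (var COUNT)))
       (Assign OUT (var COUNT) (var CENTRE)))).

(** The outer test is 0 exactly when [NEAR] from vertex 0 equals the level plus 1; rising levels
    thus visit vertices by decreasing distance from vertex 0. *)
Definition scan (slack : nat) : program :=
  for_vertices 12 (for_vertices 13 (Branch
    (Plus (Minus (entry_expr NEAR (Const 0) (var 13)) (incr (var 12)))
       (Minus (incr (var 12)) (entry_expr NEAR (Const 0) (var 13))))
    Skip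
    (Branch (Minus radius (Get STAMP (var 13))) (pick slack) Skip))).

(** Too many centres leave the output length 0, the signal to try the next radius. On success,
    entries beyond the count are leftovers that serve as arbitrary activators. *)
Definition attempt (slack : nat) : program :=
  Sequence (Assign COUNT (Const 0) (Const 0)) (Sequence (scan slack)
    (Branch (Minus (var COUNT) radius)
       Skip
       (Assign OUT (Const 0) (Plus (Plus radius radius) (Const slack))))).

Definition burning_program (slack : nat) : program :=
  Sequence tables (Sequence relax
    (for_vertices 11 (Branch (var OUT) Skip (attempt slack)))).

Lemma nth_allpairs (S T : Type) (h : S -> T -> nat) s t x0 y0 i j :
  i < size s -> j < size t ->
  nth 0 [seq h x y | x <- s, y <- t] (i * size t + j) =
    h (nth x0 s i) (nth y0 t j).
Proof.
move=> + jt; elim: s i => [|x s IHs] [|i] //= lti; rewrite nth_cat size_map.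
  by rewrite mul0n add0n jt (nth_map y0).
by rewrite mulSn -addnA ltnNge leq_addr /= addKn IHs.
Qed.

(** * Correctness of the program *)

Section Verification.

Variables (n m : nat) (e : rel 'I_n) (root : 'I_n) (slack : nat).
Hypotheses (e_simple : simple_graph e) (e_conn : connected_graph e).
Hypothesis nm : n <= m.
Hypothesis root0 : root = 0 :> nat.

Let e_sym : symmetric e. Proof. by case: e_simple. Qed.

Let gdist_lt (x y : 'I_n) : gdist e x y < n.
Proof. by rewrite -[ltnRHS]card_ord gdist_ltn. Qed.

Implicit Types (s : store) (Q : store -> Prop) (x y z v c p : 'I_n).

Lemma addr_inj (a b : nat) x y : a * n + x = b * n + y -> a = b /\ x = y.
Proof.
move=> ab; have n_gt0 : 0 < n by apply: leq_ltn_trans (ltn_ord x).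
have h (c : nat) z : (c * n + z) %/ n = c /\ (c * n + z) %% n = z.
  by rewrite divnMDl // divn_small // addn0 modnMDl modn_small.
split; first by rewrite -(h a x).1 ab (h b y).1.
by apply: val_inj; rewrite /= -(h a x).2 ab (h b y).2.
Qed.

Lemma addr_eq x y x' y' : (x * n + y == x' * n + y') = (x == x') && (y == y').
Proof.
by apply/eqP/andP => [/addr_inj[/val_inj-> ->]|[/eqP-> /eqP->]].
Qed.

Definition graph_stored s : Prop :=
  s IN 0 = n /\ forall x y, s IN (2 + (x * n + y)) = e x y.

Definition rows_stored s : Prop := forall x, s ROW x = x * n.

Lemma tables_correct s Q : graph_stored s -> (forall a i, 0 < a -> s a i = 0) ->
  (forall s', (forall a, a \notin writes tables -> s' a =1 s a) ->
    rows_stored s' ->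
     (forall x z, s' NEAR (x * n + z) = if x == z then n else 0) -> Q s') ->
  runs m tables s Q.
Proof.
move=> [sn _] s0 HQ.
pose I k s1 := (forall i, i <= k -> s1 ROW i = i * n) /\
  forall x z, s1 NEAR (x * n + z) = if (x == z) && (x < k) then n else 0.
apply: (@runs_for _ _ _ _ I); rewrite ?sn //.
- rewrite /I /update; split=> [i|x z] /=; last by rewrite s0 // andbF.
  by rewrite leqn0 => /eqP->; rewrite s0.
- move=> k s1 kn s1k fr [rows near].
  apply/runs_sequence/runs_assign/runs_assign.
  rewrite /I /update /= s1k (fr IN) // sn rows //; split=> [i|x z].
    rewrite leq_eqVlt addn1 => /predU1P[->|ik];
      first by rewrite eqxx mulSn addnC.
    by rewrite ltn_eqF // rows.
  rewrite near (addr_eq x z (Ordinal kn) (Ordinal kn)) -!val_eqE /=.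
  suff -> : (x == z :> nat) && (x < k.+1) =
      (x == k :> nat) && (z == k :> nat) || (x == z :> nat) && (x < k).
    by case: ifP.
  lia.
- move=> s1 fr [rows near]; apply: HQ => //.
    by move=> x; apply: rows; apply: ltnW.
  by move=> x z; rewrite near ltn_ord andbT.
Qed.

Definition near_stored s : Prop := forall x y,
  s NEAR (x * n + y) = n - gdist e x y.

(** Bellman-Ford for all pairs: after [k] rounds the distances up to [k] are exact, and all
    distances are below [n]. In-place updates may run ahead within a round, but never past the true
    value. *)
Lemma relax_correct s Q : graph_stored s -> rows_stored s ->
  (forall x z, s NEAR (x * n + z) = if x == z then n else 0) ->
  (forall s', (forall a, a \notin writes relax -> s' a =1 s a) ->
    near_stored s' -> Q s') ->
  runs m relax s Q.
Proof.
move=> [sn adj] rows diag HQ.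
pose sound s1 := forall x z, s1 NEAR (x * n + z) <= n - gdist e x z.
pose I7 k s1 := sound s1 /\
  forall x z, gdist e x z <= k -> n - gdist e x z <= s1 NEAR (x * n + z).
apply: (@runs_for _ _ _ _ I7); rewrite ?sn //.
  split=> [x z|x z]; rewrite /update /= diag.
    by case: eqVneq => // ->; rewrite gdistxx // subn0.
  by rewrite leqn0 => /eqP/gdist_eq0 -> //; rewrite eqxx leq_subr.
- move=> k s7 kn s7k fr7 [snd7 reach7].
  (* [pos] is the lexicographic rank of the triple of loop variables, so the three inner loops share
     one invariant; its lower bounds refer to [s7], the store at the start of the round. *)
  pose I pos s1 := [/\ sound s1, forall i, s7 NEAR i <= s1 NEAR i &
    forall x y z, (x * n + y) * n + z < pos -> e y z ->
      (s7 NEAR (x * n + y)).-1 <= s1 NEAR (x * n + z)].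
  apply: (@runs_for _ _ _ _ (fun x : nat => I (x * n * n)));
    rewrite ?fr7 ?sn //.
  + move=> x s8 xn s8x fr8 I8.
    apply: (@runs_for _ _ _ _ (fun y : nat => I ((x * n + y) * n)));
      rewrite ?fr8 ?fr7 ?sn //.
    * by rewrite addn0.
    * move=> y s9 yn s9y fr9 I9.
      apply: (@runs_for _ _ _ _ (fun z : nat => I ((x * n + y) * n + z)));
        rewrite ?fr9 ?fr8 ?fr7 ?sn //.
      -- by rewrite addn0.
      -- move=> z s10 zn s10z fr10 [snd mono upto].
        have row (u : 'I_n) : s10 ROW u = u * n.
          by rewrite fr10 // fr9 // fr8 // fr7.
        have arc (u w : 'I_n) : s10 IN (2 + (u * n + w)) = e u w.
          by rewrite fr10 // fr9 // fr8 // fr7.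
        have s10x : s10 8 0 = x by rewrite fr10 // fr9.
        have s10y : s10 9 0 = y by rewrite fr10.
        pose X := Ordinal xn; pose Y := Ordinal yn; pose Z := Ordinal zn.
        apply: runs_branch => /=; rewrite s10z s10y (row Y) (arc Y Z) => eYZ.
          have {}eYZ : e Y Z by case: (e Y Z) eYZ.
          apply: runs_assign; rewrite /= s10x s10y s10z (row X) subn1.
          set old := s10 NEAR (X * n + z); set new := old + _.
          have new_ge : (s10 NEAR (X * n + y)).-1 <= new by rewrite /new; lia.
          rewrite /I /update; split=> [u w|i|u v w] /=.
          ++ rewrite (addr_eq u w X Z);
             case: ifP => [/andP[/eqP-> /eqP->]|_ //].
             have := gdist_edge e_conn X eYZ; have := snd X Y; have := snd X Z.
             by rewrite /new /old /=; lia.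
          ++ by case: eqP => [->|_ //];
             apply: leq_trans (mono _) (leq_addr _ _).
          ++ rewrite addnS ltnS leq_eqVlt => /predU1P[|/upto up evw].
               move/(addr_inj (y := Z)) => [/(addr_inj (y := Y))[uX ->] ->] _.
               rewrite (_ : u = X) ?eqxx; last exact: val_inj.
               by apply: leq_trans new_ge; rewrite -!subn1 leq_sub2r.
             apply: leq_trans (up evw) _; case: eqP => [->|//].
             exact: leq_addr.
        apply: runs_skip; rewrite /I /update; split=> // u v w;
          rewrite addnS ltnS leq_eqVlt.
        case/predU1P=> [|/upto //].
        move/(addr_inj (y := Z)) => [/(addr_inj (y := Y))[_ ->] ->].
        by case: (e Y Z) eYZ.
      -- by move=> s10 fr10; rewrite addnS mulSn [n + _]addnC.
    * by move=> s9 fr9; rewrite mulSn [n + _]addnC.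
  + move=> s8 fr8 [snd mono upto]; split=> // x z.
    rewrite leq_eqVlt => /predU1P[|/reach7]; last first.
      by move=> /leq_trans; apply; apply: mono.
    move=> /[dup] dxz /gdist_pred[|y dxy eyz //]; first by [].
    apply: leq_trans (upto x y z _ eyz).
      have := reach7 x y; rewrite dxy dxz leqnn => /(_ isT); lia.
    by have := ltn_ord x; have := ltn_ord y; have := ltn_ord z; nia.
- move=> s7 fr7 [snd7 reach7]; apply: HQ => // x y.
  by apply/eqP; rewrite eqn_leq snd7 reach7 // ltnW.
Qed.

Definition prepared s : Prop := [/\ s IN 0 = n, rows_stored s & near_stored s].

Lemma prepared_frame s s' : prepared s ->
  s' IN =1 s IN -> s' ROW =1 s ROW -> s' NEAR =1 s NEAR -> prepared s'.
Proof.
move=> [sn rows near] frI frR frN; split; first by rewrite frI.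
  by move=> x; rewrite frR.
by move=> x y; rewrite frN.
Qed.

Lemma dist_stored s x y : prepared s ->
  s IN 0 - s NEAR (s ROW x + y) = gdist e x y.
Proof.
case=> sn rows near; rewrite sn rows near subKn //.
by apply: ltnW.
Qed.

Lemma dist_root_stored s x : prepared s ->
  s IN 0 - s NEAR (s ROW 0 + x) = gdist e root x.
Proof. by move=> prep; rewrite -(dist_stored root x prep) root0. Qed.

Lemma search_correct s k v Q : prepared s -> s 11 0 = k -> s 13 0 = v ->
  (forall s' c, (forall a, a \notin writes search -> s' a =1 s a) ->
    s' CENTRE 0 = c ->
     gdist e v c <= k.+1 -> gdist e root c <= gdist e root v - k.+1 -> Q s') ->
  runs m search s Q.
Proof.
move=> prep sk sv HQ; have [sn _ _] := prep.
pose good c :=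
  (gdist e v c <= k.+1) && (gdist e root c <= gdist e root v - k.+1).
have [c0 good_c0] : exists c, good c.
  (* The point of a geodesic from [root] to [v] at distance [k.+1] from [v], or [root] if [v] is
     closer. *)
  have [c dc dcv] := geodesic_point e_conn (leq_subr k.+1 (gdist e root v)).
  exists c; rewrite /good dc leqnn andbT (gdist_sym e_sym e_conn) dcv; lia.
pose I j s1 := (exists2 c, good c & c < j) ->
  exists2 c : 'I_n, s1 CENTRE 0 = c & good c.
apply: (@runs_for _ _ _ _ I); rewrite ?sn //.
- by case.
- move=> j s1 jn s1j fr Is1; pose c := Ordinal jn.
  have prep1 : prepared s1 by apply: prepared_frame prep _ _ _; apply: fr.
  have s1k : s1 11 0 = k by rewrite fr.
  have s1v : s1 13 0 = v by rewrite fr.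
  have good_c : (Defs.eval s1 (Plus (Minus (dist_expr (var 13) (var 14)) radius)
      (Minus (dist_expr (Const 0) (var 14))
        (Minus (dist_expr (Const 0) (var 13)) radius)))
      == 0) = good c.
    rewrite /= s1v s1j s1k !dist_root_stored // (dist_root_stored c prep1).
    by rewrite (dist_stored v c prep1) addn1 addn_eq0 !subn_eq0.
  apply: runs_branch => [ne0|eq0].
    apply: runs_skip => -[c' gc']; rewrite ltnS leq_eqVlt => /predU1P[c'j|c'j].
      by rewrite good_c (_ : c = c') ?gc' // in ne0; apply: val_inj.
    by apply: Is1; exists c'.
  by apply: runs_assign => _; exists c; rewrite -?good_c ?eq0 // /update /= s1j.
- move=> s1 fr /(_ _) []; first by exists c0.
  by move=> c s1c /andP[vc rc]; apply: HQ s1c vc rc.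
Qed.

Lemma mark_correct s k c Q : prepared s -> s 11 0 = k -> s CENTRE 0 = c ->
  (forall s', (forall a, a \notin writes (mark slack) -> s' a =1 s a) ->
     (forall x, s' STAMP x =
       if gdist e c x <= k.+1 + slack then k.+1 else s STAMP x) ->
     Q s') ->
  runs m (mark slack) s Q.
Proof.
move=> prep sk sc HQ; have [sn _ _] := prep.
pose I j s1 := forall x,
  s1 STAMP x =
    if (x < j) && (gdist e c x <= k.+1 + slack) then k.+1 else s STAMP x.
apply: (@runs_for _ _ _ _ I); rewrite ?sn //.
- move=> j s1 jn s1j fr Is1; pose x := Ordinal jn.
  have prep1 : prepared s1 by apply: prepared_frame prep _ _ _; apply: fr.
  have s1k : s1 11 0 = k by rewrite fr.
  have s1c : s1 CENTRE 0 = c by rewrite fr.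
  apply: runs_branch; rewrite /= s1c s1j s1k (dist_stored c x prep1) addn1.
    move=> far; apply: runs_skip => y;
      rewrite /update /= Is1 ltnS (leq_eqVlt y).
    case: eqVneq => //= yj; rewrite (_ : y = x); last exact: val_inj.
    by rewrite ltnn /= -subn_eq0 (negPf far).
  move=> /eqP near; apply: runs_assign => y;
    rewrite /update /= s1j s1k Is1 ltnS (leq_eqVlt y).
  case: eqVneq => //= yj; rewrite (_ : y = x); last exact: val_inj.
  by rewrite -subn_eq0 near addn1.
- by move=> s1 fr Is1; apply: HQ => // x; rewrite Is1 ltn_ord.
Qed.

(* ps lists the scanned vertices that were given a centre; the program itself
   keeps only the centres. *)
Definition greedy r (ps : seq 'I_n) s : Prop :=
  [/\ s COUNT 0 = size ps,
      pairwise (fun p q => r.*2 < gdist e p q) ps,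
      forall p x, p \in ps -> gdist e root x <= gdist e root p ->
        gdist e p x <= r.*2 -> s STAMP x = r
    & forall x, s STAMP x = r -> exists (i : nat) (c : 'I_n),
        [/\ 0 < i <= s COUNT 0, s OUT i = c & gdist e c x <= r + slack]].

(** No schedule is written yet. Stamps at most [r] ensure that the next radius finds no vertex
    already covered, and leftover output entries must name vertices too. *)
Definition pending r s : Prop :=
  [/\ forall x, s STAMP x <= r, s OUT 0 = 0 & forall i, 0 < i -> s OUT i < n].

Hypothesis retreat : forall v x c r,
  gdist e root x <= gdist e root v -> gdist e v x <= r.*2 ->
  gdist e v c <= r -> gdist e root c <= gdist e root v - r ->
  gdist e c x <= r + slack.

(** An earlier [p] within [2r] of [v], being no closer to the root, would have had [v] stamped by
    its centre; so the uncovered [v] extends the packing. *)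
Lemma pick_correct s k v ps Q : prepared s -> s 11 0 = k -> s 13 0 = v ->
  greedy k.+1 ps s -> pending k.+1 s -> s STAMP v != k.+1 ->
  (forall p, p \in ps -> gdist e root v <= gdist e root p) ->
  (forall s', (forall a, a \notin writes (pick slack) -> s' a =1 s a) ->
     greedy k.+1 (v :: ps) s' -> pending k.+1 s' ->
     (forall x, s STAMP x = k.+1 -> s' STAMP x = k.+1) ->
       s' STAMP v = k.+1 -> Q s') ->
  runs m (pick slack) s Q.
Proof.
move=> prep sk sv [cnt far retire cov] [stamp_le out0 out_lt] v_new v_min HQ.
apply: runs_frame; apply/runs_sequence.
apply: (search_correct prep sk sv) => s1 c fr1 s1c vc rc; apply/runs_sequence.
have prep1 : prepared s1 by apply: prepared_frame prep _ _ _; apply: fr1.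
have s1k : s1 11 0 = k by rewrite fr1.
apply: (mark_correct prep1 s1k s1c) => s2 fr2 s2E.
apply/runs_sequence/runs_assign/runs_assign => fr.
have covered x : gdist e root x <= gdist e root v -> gdist e v x <= k.+1.*2 ->
    s2 STAMP x = k.+1.
  by move=> rx vx; rewrite s2E (retreat rx vx vc rc).
have kept x : s STAMP x = k.+1 -> s2 STAMP x = k.+1.
  by move=> sx; rewrite s2E fr1 // sx; case: ifP.
apply: HQ fr _ _ _ _;
  rewrite /update /= ?(fr2 COUNT) ?(fr2 CENTRE) //
    ?s1c ?(fr1 COUNT) // ?cnt ?addn1.
- split=> //=.
  + rewrite far andbT; apply/allP => p pps; rewrite ltnNge.
    apply: contra v_new => vp; apply/eqP; apply: retire pps (v_min _ pps) _.
    by rewrite (gdist_sym e_sym e_conn).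
  + move=> p x; rewrite inE => /predU1P[-> |pps rx px]; first exact: covered.
    by apply: kept; apply: retire pps rx px.
  + move=> x; rewrite s2E; case: ifP => [cx _|_].
      by exists (size ps).+1, c; rewrite eqxx; split=> //; rewrite ?leqnn.
    rewrite fr1 // => /cov[i [c' [/andP[i_gt0 ile] si c'x]]].
    exists i, c'; rewrite fr2 // fr1 // cnt in ile *.
    by rewrite i_gt0 leqW ?ltn_eqF.
- split=> [x||i i_gt0] /=; first by rewrite s2E fr1 //; case: ifP.
    by rewrite fr2 // fr1.
  by case: eqP => // _; rewrite fr2 // fr1 // out_lt.
- by apply: covered; rewrite ?gdistxx.
Qed.

Lemma scan_correct s k Q : prepared s -> s 11 0 = k -> s COUNT 0 = 0 ->
  pending k s ->
  (forall s' ps, (forall a, a \notin writes (scan slack) -> s' a =1 s a) ->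
     greedy k.+1 ps s' -> pending k.+1 s' ->
     (forall x, s' STAMP x = k.+1) -> Q s') ->
  runs m (scan slack) s Q.
Proof.
move=> prep sk cnt0 [stamp_le out0 out_lt] HQ; have [sn _ _] := prep.
pose near x := n - gdist e root x.
(* Level [g] is under way: chosen vertices have level at most [g], and all lower levels are covered.
   Levels start at 1 because distances are below [n], hence the shift against the loop counter. *)
pose J g s1 := [/\
  exists2 ps, greedy k.+1 ps s1 & forall p, p \in ps -> near p <= g,
  pending k.+1 s1 & forall x, near x <= g.-1 -> s1 STAMP x = k.+1].
apply: (@runs_for _ _ _ _ (fun g => J g.+1)); rewrite ?sn //.
- split.
  + exists [::] => //; split=> // x; rewrite /update /= => sx.
    by have := stamp_le x; rewrite sx ltnn.
  + by split=> // x; apply: leq_trans (stamp_le x) _.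
  + by move=> x; rewrite leqn0 subn_eq0 leqNgt gdist_lt.
- move=> g s12 gn s12g fr12 J12.
  apply: (@runs_for _ _ _ _ (fun (j : nat) s1 => J g.+1 s1 /\
    forall x, x < j -> near x <= g.+1 -> s1 STAMP x = k.+1));
      rewrite ?fr12 ?sn //.
  + move=> j s1 jn s1j fr13 [[[ps gps ps_near] pend stamped] upto].
    pose v := Ordinal jn.
    have prep1 : prepared s1.
      by apply: prepared_frame prep _ _ _ => i; rewrite fr13 // fr12.
    have s1k : s1 11 0 = k by rewrite fr13 // fr12.
    have s1g : s1 12 0 = g by rewrite fr13.
    have nearE : s1 NEAR (s1 ROW 0 + j) = near v.
      by have [_ /(_ root) + /(_ root v)] := prep1; rewrite root0 => ->.
    have next (s2 : store) qs : greedy k.+1 qs s2 ->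
        (forall p, p \in qs -> near p <= g.+1) ->
        pending k.+1 s2 -> (forall x, s1 STAMP x = k.+1 -> s2 STAMP x = k.+1) ->
        (near v <= g.+1 -> s2 STAMP v = k.+1) ->
        J g.+1 (update s2 13 0 j.+1) /\ forall x, x < j.+1 -> near x <= g.+1 ->
          update s2 13 0 j.+1 STAMP x = k.+1.
      move=> gqs qs_near pend2 keep v_done; split.
        by split=> //; [exists qs | move=> x /stamped/keep].
      move=> x; rewrite ltnS leq_eqVlt => /predU1P[xj|xj xg];
        last by apply/keep/upto.
      by rewrite (_ : x = v); [|apply: val_inj].
    apply: runs_branch; rewrite /= s1j s1g nearE addn1.
      move=> v_level; apply: runs_skip.
      apply: (next _ _ gps ps_near pend) => // vg.
      apply: stamped; move: v_level vg; rewrite addn_eq0 !subn_eq0 /=; lia.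
    move=> /eqP; rewrite addn_eq0 !subn_eq0 => v_level.
    apply: runs_branch; rewrite /= s1j s1k addn1 => v_new; last first.
      apply: runs_skip; apply: (next _ _ gps ps_near pend) => // _.
      by have [/(_ v) le _ _] := pend;
        apply/eqP; rewrite eqn_leq le -subn_eq0 v_new.
    apply: (@pick_correct s1 k v ps _ prep1 s1k s1j gps pend).
    + by apply: contra v_new => /eqP ->; rewrite subnn.
    + move=> p /ps_near; have := gdist_lt root p; have := gdist_lt root v.
      by move: v_level; rewrite /near; lia.
    + move=> s2 fr2 g2 pend2 keep v_done; apply: next g2 _ pend2 keep _ => //.
      move=> p; rewrite inE => /predU1P[->|/ps_near //].
      by case/andP: v_level.
  + move=> s1 fr13 [[[ps gps ps_near] pend stamped] upto]; split=> //.
      by exists ps => // p /ps_near/leqW.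
    by move=> x; apply: upto.
- move=> s1 fr [[ps gps _] pend stamped]; apply: HQ fr gps pend _ => x.
  by apply: stamped; apply: leq_subr.
Qed.

Definition covering r s : Prop := forall x, exists (i : nat) (c : 'I_n),
  [/\ 0 < i <= r, s OUT i = c & gdist e c x <= r + slack].

Lemma burning_program_correct s Q :
  graph_stored s -> (forall a i, 0 < a -> s a i = 0) ->
  (forall s' r, 0 < r <= burning_number e -> s' OUT 0 = r + r + slack ->
     (forall i, 0 < i -> s' OUT i < n) -> covering r s' -> Q s') ->
  runs m (burning_program slack) s Q.
Proof.
move=> stored s0 HQ; have [sn adj] := stored.
have n_gt0 : 0 < n by apply: leq_ltn_trans (ltn_ord root).
apply/runs_sequence; apply: tables_correct => // s1 fr1 rows1 diag1.
apply/runs_sequence; apply: relax_correct => //.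
- by split=> [|x y]; rewrite fr1.
move=> s2 fr2 near2.
have s2n : s2 IN 0 = n by rewrite fr2 // fr1.
have prep2 : prepared s2 by split=> // x; rewrite fr2 // rows1.
pose I k s3 := [/\ forall x, s3 STAMP x <= k, forall i, 0 < i -> s3 OUT i < n &
  s3 OUT 0 = 0 /\ k < burning_number e \/
  exists r, [/\ 0 < r <= burning_number e, s3 OUT 0 = r + r + slack &
    covering r s3]].
apply: (@runs_for _ _ _ _ I); rewrite ?s2n //.
- rewrite /I /update; split=> [x|i _|] /=; try by rewrite fr2 // fr1 // s0.
  by left; rewrite fr2 // fr1 // s0 // burning_number_gt0.
- move=> k s3 kn s3k fr3 [stamp_le out_lt done].
  have prep3 : prepared s3 by apply: prepared_frame prep2 _ _ _; apply: fr3.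
  apply: runs_branch => /= out0.
    apply: runs_skip; split=> //= [x|]; first exact: leqW (stamp_le x).
    by case: done => [[/eqP]|]; [rewrite (negPf out0) | right].
  have {done} k_lt : k < burning_number e.
    by case: done => [[] //|[r [r_gt0]]]; rewrite out0; lia.
  apply/runs_sequence/runs_assign/runs_sequence => /=.
  have prep4 : prepared (update s3 COUNT 0 0).
    by apply: prepared_frame prep3 _ _ _.
  apply: (scan_correct prep4 (k := k)) => //.
  move=> s5 ps fr5 [cnt far _ cov] [stamp_le5 out05 out_lt5] stamped.
  have s5k : s5 11 0 = k by rewrite fr5.
  apply: runs_branch => /=; rewrite s5k cnt addn1.
    (* The chosen vertices form a packing, so more than [k.+1] of them refute
       [burning_number e <= k.+1]. *)
    move=> many; apply: runs_skip; split=> //=; left; split=> //.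
    rewrite ltnNge; apply: contra many => bn_le.
    have := burning_number_packing e_sym e_conn bn_le far.
    by rewrite subn_eq0 => /leq_trans; apply.
  move=> /eqP; rewrite subn_eq0 => few; apply: runs_assign => /=.
  rewrite s5k addn1; split=> [x|i i_gt0|].
  + exact: stamp_le5.
  + by rewrite /update /= gtn_eqF // out_lt5.
  + right; exists k.+1; split=> // x.
    have [i [c [/andP[i_gt0 i_le] ic cx]]] := cov x (stamped x).
    exists i, c; rewrite /update /= gtn_eqF // i_gt0; split=> //.
    by rewrite cnt in i_le; apply: leq_trans few.
- move=> s3 fr3 [_ out_lt [[_]|[r [r_le out0 cover]]]].
    by have := burning_number_le_card e; rewrite card_ord leqNgt => /negPf->.
  exact: HQ r_le out0 out_lt cover.
Qed.

End Verification.

(** * From the encoded input to the burning schedule *)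

Lemma input_store_encode n N (e : rel 'I_n) (f : rel 'I_N) bag :
  graph_stored e (input_store (encode e f bag)).
Proof.
split=> // x y; rewrite /input_store /encode /= nth_cat.
have szn : size (enum 'I_n) = n by rewrite size_enum_ord.
have lt : x * n + y <
    size [seq nat_of_bool (e u v) | u <- enum 'I_n, v <- enum 'I_n].
  rewrite size_allpairs szn; apply: (@leq_trans (x.+1 * n)).
    by rewrite mulSn addnC ltn_add2r.
  by rewrite leq_mul2r ltn_ord orbT.
rewrite lt; have := @nth_allpairs _ _ (fun x y => nat_of_bool (e x y))
  (enum 'I_n) (enum 'I_n) x y x y.
by rewrite szn !nth_ord_enum; apply.
Qed.

Lemma leq_size_encode n N (e : rel 'I_n) (f : rel 'I_N) bag :
  n <= size (encode e f bag).
Proof.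
rewrite /encode /= !size_cat size_allpairs size_enum_ord.
by case: n e bag => // n e bag; rewrite mulSn; lia.
Qed.

Lemma burning_program_schedule n N (e : rel 'I_n) (f : rel 'I_N)
    (bag : 'I_N -> {set 'I_n}) L :
  simple_graph e -> connected_graph e -> is_tree_decomposition e f bag ->
  td_length e bag <= L ->
  exists s : seq 'I_n,
    [/\ outputs_within (burning_program L.*2) (encode e f bag)
          (time_bound (size (encode e f bag)) (burning_program L.*2))
          [seq nat_of_ord v | v <- s],
        burns e s & size s <= (burning_number e).*2 + L.*2].
Proof.
move=> e_simple e_conn decomp len.
have e_sym : symmetric e by case: e_simple.
have n_gt0 : 0 < n by rewrite -[n]card_ord; case: e_conn.
pose root := Ordinal n_gt0.
have cover := retreat_covers e_simple e_conn decomp len.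
have [t [s' [ex tm [r [/andP[r_gt0 r_le] out0 out_lt covered]]]]] :
    runs (size (encode e f bag)) (burning_program L.*2)
      (input_store (encode e f bag))
      (fun s' => exists r, [/\ 0 < r <= burning_number e, s' 1 0 = r + r + L.*2,
         forall i, 0 < i -> s' 1 i < n & covering e L.*2 r s']).
  apply: (@burning_program_correct n _ e root) => //.
  - exact: leq_size_encode.
  - by move=> v x c r; apply: cover.
  - exact: input_store_encode.
  - by move=> [].
  - by move=> s' r *; exists r.
exists [seq insubd root (s' 1 i) | i <- iota 1 (s' 1 0)]; split.
- exists t, s'; split=> //; rewrite /output_word -map_comp.
  apply/eq_in_map => i; rewrite mem_iota => /andP[i_gt0 _] /=.
  by rewrite val_insubd out_lt.
(* The centre in output entry [i <= r] is at position [i.-1] and keeps radius at least r + 2L of the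
   2r + 2L rounds. *)
- apply/burnsP => // v; have [i [c [/andP[i_gt0 i_le] ic cv]]] := covered v.
  have ik : i.-1 < s' 1 0 by lia.
  exists i.-1; first by rewrite size_map size_iota.
  rewrite (nth_map 0) ?size_iota // nth_iota // add1n prednK //.
  rewrite size_map size_iota (_ : insubd _ _ = c); first lia.
  by apply: val_inj; rewrite val_insubd ic ltn_ord.
- by rewrite size_map size_iota out0 -!addnn; lia.
Qed.

(** * The approximation factor *)

Import Order.TTheory GRing.Theory Num.Theory.
Import numFieldNormedType.Exports.

Local Open Scope classical_set_scope.
Local Open Scope ring_scope.

Definition excess (R : realType) (L d : nat) : R :=
  (4 * L)%:R * Num.sqrt d.+1%:R^-1.

Lemma cvg_excess (R : realType) L : excess R L d @[d --> \oo] --> (0 : R).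
Proof.
rewrite -(mulr0 (4 * L)%:R) -(@sqrtr0 R); apply: cvgMr.
apply: (continuous_cvg _ (@sqrt_continuous R 0)); exact: cvg_harmonic.
Qed.

(** From [d + 1 <= 3 * b ^ 2 <= 4 * b ^ 2] follows 1 <= 2b / sqrt(d + 1); multiplying by 2L explains
    the constant 4L in [excess]. *)
Lemma excess_large (R : realType) (L d b : nat) : (d < 3 * b ^ 2)%N ->
  (L.*2)%:R <= excess R L d * b%:R.
Proof.
move=> db; have le_b : 1 <= 2 * b%:R * Num.sqrt d.+1%:R^-1 :> R.
  have pos : 0 <= 2 * b%:R * Num.sqrt d.+1%:R^-1 :> R.
    by rewrite !mulr_ge0 ?sqrtr_ge0.
  rewrite -(ler_pXn2r (ltn0Sn 1)) ?nnegrE //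
    expr1n !exprMn sqr_sqrtr ?invr_ge0 //.
  by rewrite ler_pdivlMr // mul1r -!natrX -natrM ler_nat; lia.
rewrite /excess -muln2 -[leLHS]mulr1.
apply: (le_trans (ler_wpM2l _ le_b)) => //.
by rewrite !natrM; lra.
Qed.

Theorem theorem4 (R : realType) (L : nat) :
  exists (A : program) (T : nat -> nat) (eps : nat -> R),
    [/\ polynomially_bounded T,
        forall d : nat, 0 <= eps d,
        eps d @[d --> \oo] --> (0 : R)
      & forall (n N : nat) (e : rel 'I_n) (f : rel 'I_N)
               (bag : 'I_N -> {set 'I_n}),
          simple_graph e -> connected_graph e ->
          is_tree_decomposition e f bag -> (td_length e bag <= L)%N ->
          exists s : seq 'I_n,
            [/\ outputs_within A (encode e f bag) (T (size (encode e f bag)))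
                  [seq nat_of_ord v | v <- s],
                burns e s
              & (size s)%:R <= (2 + eps (diameter e)) * (burning_number e)%:R]].
Proof.
exists (burning_program L.*2), (time_bound^~ (burning_program L.*2)),
  (excess R L).
split; first exact: time_bound_polynomial.
- by move=> d; rewrite mulr_ge0 ?sqrtr_ge0.
- exact: cvg_excess.
- move=> n N e f bag e_simple e_conn decomp len.
  have [s [out bs size_s]] :=
    burning_program_schedule e_simple e_conn decomp len.
  exists s; split=> //; have [e_sym _] := e_simple.
  have := excess_large R L (diameter_lt_burning_number e_sym e_conn).
  by move: size_s; rewrite -(ler_nat R) natrD -muln2 natrM; lra.
Qed.
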